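(* Let $E$ be a finite-dimensional Banach space and let $\mu\colon\mathcal B_E\to[0,+\infty)$. Then $\mu$ is an axiomatic measure of non-compactness if and only if the following three conditions hold: (a1) the family $\ker\mu=\{A\in\mathcal B_E:\mu(A)=0\}$ is non-empty; (a2) for any $A,B\in\mathcal B_E$, if $A\subseteq B$, then $\mu(A)\le\mu(B)$; (a3) there exists $\lambda\in(0,1)$ such that $\mu(\lambda A+(1-\lambda)B)\le\lambda\mu(A)+(1-\lambda)\mu(B)$ for all $A,B\in\mathcal B_E$.
   Context: $E$ is a real or complex Banach space; $\mathcal B_E$ denotes the family of all non-empty bounded subsets of $E$, and $\mathcal K_E\subseteq\mathcal B_E$ the subfamily of relatively compact sets. $\operatorname{conv}A$ is the (not necessarily closed) convex hull; $A+B=\{a+b: a\in A, b\in B\}$, $\lambda A=\{\lambda a: a\in A\}$. A function $\mu\colon\mathcal B_E\to[0,+\infty)$ is an axiomatic measure of non-compactness if, with $\ker\mu=\{A\in\mathcal B_E:\mu(A)=0\}$: (A1) $\ker\mu$ is non-empty and $\ker\mu\subseteq\mathcal K_E$; (A2) for all $A,B\in\mathcal B_E$, if $A\subseteq B$ then $\mu(A)\le\mu(B)$; (A3) $\mu(\operatorname{conv}A)=\mu(A)$ for all $A\in\mathcal B_E$; (A4) $\mu(\lambda A+(1-\lambda)B)\le\lambda\mu(A)+(1-\lambda)\mu(B)$ for all $A,B\in\mathcal B_E$ and all $\lambda\in[0,1]$; (A5) if $A_n\in\mathcal B_E$ ($n\in\mathbb N$) are closed, $A_{n+1}\subseteq A_n$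 for all $n$, and $\mu(A_n)\to0$, then $\bigcap_{n=1}^\infty A_n\ne\emptyset$. *)

(* Defs.v *)
From mathcomp Require Import all_boot all_order all_algebra.
From mathcomp Require Import complex.
From mathcomp Require Import all_classical all_reals all_analysis.
Import Order.TTheory GRing.Theory Num.Theory.
Import numFieldNormedType.Exports.

Set Implicit Arguments.
Unset Strict Implicit.
Unset Printing Implicit Defensive.

Local Open Scope classical_set_scope.
Local Open Scope ring_scope.

Definition finite_dimensional (K : fieldType) (E : lmodType K) : Prop :=
  exists (n : nat) (e : 'I_n -> E),
    forall x : E, exists c : 'I_n -> K, x = \sum_(i < n) c i *: e i.

(* The family B_E of non-empty bounded subsets of E. *)
Definition nebounded (K : numFieldType) (E : normedModType K) : set (set E) :=
  [set A | A !=set0 /\ bounded_set A].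

(* [convex_set] only involves scalars between 0 and 1 in the order of K. For
   K = R[i] such scalars are real, so this is the usual convex hull even over
   the complex numbers. It is not closed. *)
Definition convex_hull (K : numFieldType) (E : lmodType K) (A : set E) :
  set E := smallest (@convex_set K E) A.

Section measure_of_noncompactness.
(* The scalar field K is R or R[i], and emb embeds R into it: measures of
   non-compactness and the coefficients of convex combinations are real in both
   cases. *)
Context {R : realType} {K : numFieldType} (emb : R -> K)
  {E : completeNormedModType K}.

(* l A + (1 - l) B *)
Definition convex_comb (l : R) (A B : set E) : set E :=
  [set emb l *: a + emb (1 - l) *: b | a in A & b in B].

(* A function B_E -> [0, +oo[ is represented by a total function on sets that is
   nonnegative on B_E. Its values outside B_E are never used: all the conditions
   below are restricted to B_E, which is stable under [convex_hull] and, for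
   0 <= l <= 1, under [convex_comb l]. *)
Definition nonneg_on_nebounded (mu : set E -> R) : Prop :=
  forall A, nebounded A -> 0 <= mu A.

Definition mnc_ker (mu : set E -> R) : set (set E) :=
  [set A | nebounded A /\ mu A = 0].

Definition mnc_monotone (mu : set E -> R) : Prop :=
  forall A B, nebounded A -> nebounded B -> A `<=` B -> mu A <= mu B.

Definition mnc_convex_at (mu : set E -> R) (l : R) : Prop :=
  forall A B, nebounded A -> nebounded B ->
    mu (convex_comb l A B) <= l * mu A + (1 - l) * mu B.

Record axiomatic_mnc (mu : set E -> R) : Prop := AxiomaticMnc {
  mnc_ker_neq0 : mnc_ker mu !=set0;
  mnc_ker_precompact : mnc_ker mu `<=` [set A | precompact A];
  mnc_le : mnc_monotone mu;
  mnc_convex_hull : forall A, nebounded A -> mu (convex_hull A) = mu A;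
  mnc_convex : forall l : R, 0 <= l <= 1 -> mnc_convex_at mu l;
  mnc_bigcap_neq0 : forall A : nat -> set E,
    (forall n, nebounded (A n)) -> (forall n, closed (A n)) ->
    (forall n, A n.+1 `<=` A n) -> mu (A n) @[n --> \oo] --> (0 : R) ->
    \bigcap_n A n !=set0
}.

End measure_of_noncompactness.

(* Main.v *)
Require Import Defs.
From mathcomp Require Import all_boot all_order all_algebra.
From mathcomp Require Import complex.
From mathcomp Require Import all_classical all_reals all_analysis.
From mathcomp Require Import ring lra.
Import Order.TTheory GRing.Theory Num.Theory.
Import numFieldNormedType.Exports.
Local Open Scope classical_set_scope.
Local Open Scope ring_scope.

(** An axiomatic measure of non-compactness satisfies the three conditions by
    definition. Conversely, let mu be monotone and convex at a single l in
    ]0, 1[.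

    Two of the missing axioms only express that bounded subsets of E are
    relatively compact ([bounded_precompact]). It remains to recover
    convexity at every coefficient and invariance under convex hulls.

    The coefficients at which mu is convex contain 0 and 1 and are stable under
    l-combinations, because an l-combination of s a + (1 - s) b and
    r a + (1 - r) b is again a combination of a and b; hence they are dense in
    [0, 1] ([mnc_convex_at_dense], [dense_of_comb_closed]). Density yields a
    continuity property of mu ([mnc_le_of_approx]): if every point of A is
    within 1 - r of C, for such a coefficient r, then A lies in r C + (1 - r) B
    for a fixed ball B, whence mu A <= r mu C + (1 - r) mu B, and the last term
    vanishes as r tends to 1.

    Convexity at t follows, as t A + (1 - t) B is close to s A + (1 - s) B for
    s close to t ([mnc_convex_everywhere]). For hulls, iterating
    X |-> l X + (1 - l) X from A never increases mu, and the iterates grow to a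
    set whose closure is convex, hence contains conv A. As this closure is
    compact, a single iterate is already uniformly close to conv A
    ([convex_hull_approx]), so mu (conv A) <= mu A ([mnc_convex_hull_eq]).

    The real and the complex case are treated together, over a field K with an
    order embedding emb of the reals such that every element of K has real
    coordinates on 1 and some im, bounded by its norm: im = 0 over the reals,
    im = 'i over the complex numbers. *)

(** * Dense sets of coefficients *)

(** Bisection: cut an interval around t with endpoints in D at the
    l-combination of its endpoints; its length shrinks by at least
    max(l, 1 - l) < 1. *)
Lemma dense_of_comb_closed {R : realType} (l : R) (D : set R) :
  0 < l < 1 -> D 0 -> D 1 ->
  (forall s r, D s -> D r -> D (l * s + (1 - l) * r)) ->
  forall t e, 0 <= t <= 1 -> 0 < e ->
    exists s, [/\ D s, 0 <= s, s <= t & t - s <= e].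
Proof.
move=> /andP[l0 l1] D0 D1 Dcomb t e /andP[t0 t1] e0.
pose q := Num.max l (1 - l).
have [lq l'q] : l <= q /\ 1 - l <= q by rewrite !le_max !lexx orbT.
have q1 : q < 1 by rewrite gt_max l1; lra.
have q0 : 0 <= q by lra.
suff bisect n : exists a b,
    [/\ D a, D b, 0 <= a <= t, t <= b <= 1 & b - a <= q ^+ n].
  have /cvgrPdist_le/(_ e e0)[n _ /(_ n (leqnn n))] : q ^+ n @[n --> \oo] --> 0.
    by apply: cvg_expr; rewrite ger0_norm.
  rewrite sub0r normrN ger0_norm ?exprn_ge0// => qe.
  have [a [b [Da _ /andP[a0 at_] /andP[tb _] ab]]] := bisect n.
  by exists a; split => //; lra.
elim: n => [|n [a [b [Da Db /andP[a0 at_] /andP[tb b1] ab]]]].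
  by exists 0, 1; split => //; rewrite ?expr0; lra.
have qn0 : 0 <= q ^+ n by rewrite exprn_ge0.
have abl : (b - a) * l <= q * q ^+ n.
  by rewrite mulrC; apply: ler_pM => //; lra.
have abl' : (b - a) * (1 - l) <= q * q ^+ n.
  by rewrite mulrC; apply: ler_pM => //; lra.
pose m := l * a + (1 - l) * b.
have Dm : D m by exact: Dcomb.
have [am mb] : a <= m /\ m <= b by rewrite /m; split; nra.
have [tm|mt] := leP t m.
  exists a, m; split => //; rewrite ?a0 ?at_ ?tm ?(le_trans mb)// exprS.
  by apply: le_trans abl'; rewrite /m; lra.
exists m, b; split => //; rewrite ?tb ?b1 ?(ltW mt) ?(le_trans a0)// exprS.
by apply: le_trans abl; rewrite /m; lra.
Qed.

(** * Convexity and closure with real coefficients *)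

Section real_scalars.
Context {R : realType} {K : numFieldType} (emb : {rmorphism R -> K}).
Context (emb_le : {mono emb : x y / x <= y})
  (emb_onto : forall k : K, 0 <= k -> exists r, k = emb r).

Let embB1 (t : R) : emb (1 - t) = 1 - emb t.
Proof. by rewrite rmorphB rmorph1. Qed.

Let emb_ge0 (r : R) : (0 <= emb r) = (0 <= r).
Proof. by rewrite -(rmorph0 emb) emb_le. Qed.

Let emb_gt0 (r : R) : (0 < emb r) = (0 < r).
Proof. by rewrite -(rmorph0 emb) (leW_mono emb_le). Qed.

Lemma bounded_embP {E : normedModType K} (A : set E) :
  bounded_set A <-> exists2 M : R, 0 < M & forall x, A x -> `|x| <= emb M.
Proof.
split=> [/ex_strict_bound_gt0[M M0 AM]|[M M0 AM]].
  have [r rE] := emb_onto _ (ltW M0); exists r; first by rewrite -emb_gt0 -rE.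
  by move=> x /AM; rewrite -rE; exact: ltW.
have Mreal : emb M \is Num.real by rewrite ger0_real// emb_ge0 ltW.
exists (emb M); split=> // m Mm x /AM xM; exact: le_trans xM (ltW Mm).
Qed.

Section approximation.
Context {E : normedModType K}.
Implicit Types (A B W : set E) (x y : E).

Lemma norm_embP x : exists2 M : R, 0 < M & `|x| <= emb M.
Proof.
have [r rE] := emb_onto _ (normr_ge0 x).
have r0 : 0 <= r by rewrite -emb_ge0 -rE.
by exists (r + 1); [lra|rewrite rE emb_le; lra].
Qed.

Lemma comb_nested (l s r : R) x y :
  emb l *: (emb s *: x + emb (1 - s) *: y) +
    emb (1 - l) *: (emb r *: x + emb (1 - r) *: y) =
  emb (l * s + (1 - l) * r) *: x + emb (1 - (l * s + (1 - l) * r)) *: y.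
Proof.
rewrite !scalerDr !scalerA -!rmorphM addrACA -!scalerDl -!rmorphD.
by congr (_ + emb _ *: _); ring.
Qed.

Lemma comb_subl (t s : R) x y :
  emb t *: x + emb (1 - t) *: y - (emb s *: x + emb (1 - s) *: y) =
  emb (t - s) *: (x - y).
Proof.
rewrite !embB1 rmorphB opprD addrACA -!scalerBl scalerBr -scaleNr.
by congr (_ + _ *: _); ring.
Qed.

Lemma norm_comb_le (t a b : R) x y : 0 <= t <= 1 ->
  `|x| <= emb a -> `|y| <= emb b ->
  `|emb t *: x + emb (1 - t) *: y| <= emb (t * a + (1 - t) * b).
Proof.
move=> /andP[t0 t1] xa yb; apply: le_trans (ler_normD _ _) _.
have t1' : 0 <= 1 - t by lra.
rewrite !normrZ !ger0_norm ?emb_ge0//.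
by rewrite (rmorphD emb (t * a)) !rmorphM lerD// ler_wpM2l// emb_ge0.
Qed.

(** Every positive radius in K is the image of a real, so that real radii
    suffice to describe the topology of E. *)
Lemma closure_embP W x :
  closure W x <->
  forall d : R, 0 < d -> exists2 y, W y & `|x - y| <= emb d.
Proof.
split=> [Wx d d0|Wx U /nbhs_ballP[e e0 xU]].
  have [|y [Wy]] := Wx (ball x (emb d)).
    by apply: nbhsx_ballx; rewrite emb_gt0.
  by rewrite -ball_normE /= => /ltW xy; exists y.
have [r rE] := emb_onto _ (ltW e0).
have r0 : 0 < r / 2 by rewrite divr_gt0// -emb_gt0 -rE.
have [y Wy xy] := Wx _ r0; exists y; split => //; apply: xU.
rewrite -ball_normE /= rE; apply: le_lt_trans xy _.
by rewrite (leW_mono emb_le); lra.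
Qed.

Definition comb_closed (l : R) W :=
  forall x y, W x -> W y -> W (emb l *: x + emb (1 - l) *: y).

Lemma comb_closed_closure l W : 0 <= l <= 1 ->
  comb_closed l W -> comb_closed l (closure W).
Proof.
move=> l01 Wl x y /closure_embP Wx /closure_embP Wy; apply/closure_embP => d d0.
have [x' Wx' xx'] := Wx d d0; have [y' Wy' yy'] := Wy d d0.
exists (emb l *: x' + emb (1 - l) *: y'); first exact: Wl.
rewrite opprD addrACA -!scalerBr.
have -> : emb d = emb (l * d + (1 - l) * d) by congr (emb _); ring.
exact: norm_comb_le.
Qed.

(** The coefficients s for which s x + (1 - s) y lies in W are stable under
    l-combinations, hence dense, and W is closed. *)
Lemma convex_of_comb_closed l W : 0 < l < 1 -> closed W -> comb_closed l W ->
  forall t : R, 0 <= t <= 1 -> comb_closed t W.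
Proof.
move=> l01 cW Wl t t01 x y Wx Wy.
pose D := [set s : R | W (emb s *: x + emb (1 - s) *: y)].
have D0 : D 0 by rewrite /D /= subr0 rmorph0 rmorph1 scale0r scale1r add0r.
have D1 : D 1 by rewrite /D /= subrr rmorph0 rmorph1 scale0r scale1r addr0.
have Dl s r : D s -> D r -> D (l * s + (1 - l) * r).
  by move=> Ds Dr; rewrite /D /= -comb_nested; exact: Wl.
rewrite (closure_id W).1//; apply/closure_embP => d d0.
have [M M0 xyM] := norm_embP (x - y).
have [|s [Ds s0 st ts]] := dense_of_comb_closed l D l01 D0 D1 Dl t (d / M) t01.
  exact: divr_gt0.
exists (emb s *: x + emb (1 - s) *: y) => //.
have ts0 : 0 <= t - s by lra.
rewrite comb_subl normrZ ger0_norm ?emb_ge0//.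
apply: (@le_trans _ _ (emb (d / M) * emb M)).
  by apply: ler_pM; rewrite ?emb_ge0 ?emb_le.
by rewrite -rmorphM divfK// gt_eqF.
Qed.

(** Scalars of K between 0 and 1 are images of reals, even when K is the field
    of complex numbers. *)
Lemma convex_set_embP W :
  convex_set W <-> forall t : R, 0 <= t <= 1 -> comb_closed t W.
Proof.
split=> [cW t /andP[t0 t1] x y Wx Wy|cW x y k /set_mem Wx /set_mem Wy].
  have e0 : 0 <= emb t by rewrite emb_ge0.
  have e1 : emb t <= 1 by rewrite -(rmorph1 emb) emb_le.
  have := cW x y (Itv01 e0 e1) (mem_set Wx) (mem_set Wy).
  by move=> /set_mem; rewrite /conv /= embB1.
have [t tE] := emb_onto k%:num (ge0 _).
have k1 : k%:num <= emb 1 by rewrite rmorph1 le1.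
apply/mem_set; have := cW t; rewrite /comb_closed embB1 -tE; apply => //.
by rewrite -emb_ge0 -emb_le -tE ge0.
Qed.

Lemma convex_normball (M : R) : convex_set [set x : E | `|x| <= emb M].
Proof.
apply/convex_set_embP => t t01 x y xM yM /=.
have -> : emb M = emb (t * M + (1 - t) * M) by congr (emb _); ring.
exact: norm_comb_le.
Qed.

End approximation.

(** * Relative compactness of bounded sets in finite dimension *)

Context (im : K) (emb_coord : forall (k : K) (r : R), `|k| <= emb r ->
  exists a b, [/\ `|a| <= r, `|b| <= r & k = emb a + im * emb b]).

Lemma emb_norm (r : R) : `|emb r| = emb `|r|.
Proof.
have [r0|r0] := ger0P r; first by rewrite ger0_norm ?emb_ge0.
by rewrite -normrN -rmorphN ger0_norm// emb_ge0 oppr_ge0 ltW.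
Qed.

Lemma continuous_emb : continuous (emb : R -> K).
Proof.
move=> x; apply/cvgrPdist_lt => e e0.
have [r rE] := emb_onto _ (ltW e0).
have r0 : 0 < r by rewrite -emb_gt0 -rE.
near=> y; rewrite -rmorphB emb_norm rE (leW_mono emb_le).
by near: y; apply: cvgr_dist_lt r0; exact: cvg_id.
Unshelve. all: by end_near. Qed.

(** The disk lies in the image of a square under (a, b) |-> a + im b. *)
Lemma disk_sub_compact (r : R) :
  exists2 C : set K, compact C & [set k | `|k| <= emb r] `<=` C.
Proof.
pose f (z : R * R) : K := emb z.1 + im * emb z.2.
exists (f @` (`[- r, r]%classic `*` `[- r, r]%classic)).
  apply: continuous_compact; last by apply: compact_setX; exact: segment_compact.
  apply: continuous_subspaceT => z; apply: cvgD.
    exact: (continuous_comp cvg_fst (continuous_emb _)).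
  apply: cvgM; first exact: cvg_cst.
  exact: (continuous_comp cvg_snd (continuous_emb _)).
move=> k /= /emb_coord[a [b [ar br ->]]]; exists (a, b) => //.
by split; rewrite /= in_itv /= -ler_norml.
Qed.

Section finite_dimension.
Context {E : normedModType K}.
Implicit Types (A V : set E) (x y : E).

(** The compact set is required inside V, not merely inside the ambient space:
    this makes V closed, and allows the dimension to grow by one. *)
Definition locally_compact_subspace V := [/\ V 0,
  forall (c : K) x y, V x -> V y -> V (c *: x + y) &
  forall M : R, exists C, [/\ compact C, C `<=` V &
    V `&` [set x | `|x| <= emb M] `<=` C]].

(** A limit point of V is a limit point of a bounded part of V, which lies in a
    compact, hence closed, subset of V. *)
Lemma locally_compact_subspace_closed V :
  locally_compact_subspace V -> closed V.
Proof.
move=> [_ _ VC] x Vx; have [M M0 xM] := norm_embP x.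
have [C [cC CV VMC]] := VC (M + 1); apply: CV.
rewrite (closure_id C).1; last exact: compact_closed.
apply/closure_embP => d d0; pose d' := Num.min d 1.
have d'0 : 0 < d' by rewrite lt_min d0 ltr01.
have [y Vy xy] := (closure_embP _ _).1 Vx d' d'0.
exists y; last by apply: le_trans xy _; rewrite emb_le ge_min lexx.
apply: VMC; split => //=.
rewrite -[y](subKr x); apply: le_trans (ler_normB _ _) _.
rewrite rmorphD lerD//; apply: le_trans xy _.
by rewrite emb_le ge_min lexx orbT.
Qed.

(** If e is not in V, it is at distance at least some d > 0 from V, since V is
    closed. Then |c| d <= |v + c e|, so that both v and c stay bounded when
    v + c e does. *)
Lemma locally_compact_subspace_add_line V e : locally_compact_subspace V ->
  locally_compact_subspace [set v + c *: e | v in V & c in [set: K]].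
Proof.
move=> lcV; have Vcl := locally_compact_subspace_closed _ lcV.
have [V0 Vlin VC] := lcV.
have [Ve|nVe] := pselect (V e).
  suff -> : [set v + c *: e | v in V & c in [set: K]] = V by [].
  apply/seteqP; split=> [_ [v Vv [c _ <-]]|v Vv].
    by rewrite addrC; exact: Vlin.
  by exists v => //; exists 0; rewrite // scale0r addr0.
split.
- by exists 0 => //; exists 0; rewrite // scale0r addr0.
- move=> c _ _ [v Vv [a _ <-]] [w Vw [b _ <-]].
  exists (c *: v + w); first exact: Vlin.
  by exists (c * a + b); rewrite // scalerDl scalerDr scalerA addrACA.
have [d d0 dist_e] : exists2 d : R, 0 < d &
    forall y, V y -> ~ (`|e - y| <= emb d).
  apply: contrapT => nd; apply: nVe; apply: Vcl; apply/closure_embP => d d0.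
  apply: contrapT => ny; apply: nd; exists d => // y Vy ey.
  by apply: ny; exists y.
move=> M; have [N N0 eN] := norm_embP e.
(* The distance from e to the point - c^-1 v of V is |v + c e| / |c|. *)
have coef v c : V v -> `|v + c *: e| <= emb M -> `|c| <= emb (M / d).
  move=> Vv vcM; have [r rE] := emb_onto _ (normr_ge0 c).
  rewrite rE emb_le leNgt; apply/negP => Mr.
  have M0 : 0 <= M by rewrite -emb_ge0; exact: le_trans (normr_ge0 _) vcM.
  have r0 : 0 < r by apply: le_lt_trans Mr; rewrite divr_ge0// ltW.
  have c0 : c != 0 by rewrite -normr_gt0 rE emb_gt0.
  apply: (dist_e (- c^-1 *: v + 0)); first exact: Vlin.
  have -> : e - (- c^-1 *: v + 0) = c^-1 *: (v + c *: e).
    by rewrite addr0 scaleNr opprK scalerDr scalerA mulVf// scale1r addrC.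
  rewrite normrZ normfV ler_pdivrMl ?normr_gt0// rE -rmorphM.
  apply: le_trans vcM _; rewrite emb_le -ler_pdivrMr//; exact: ltW.
have [C [cC CV VMC]] := VC (M + M / d * N).
have [Ck cCk Ckd] := disk_sub_compact (M / d).
exists ((fun z : E * K => z.1 + (z.2 : K) *: e) @` ((C `&` V) `*` Ck)); split.
- apply: continuous_compact.
    apply: continuous_subspaceT => z.
    by apply: cvgD; [exact: cvg_fst|apply: cvgZr_tmp; exact: cvg_snd].
  apply: compact_setX => //; exact: compact_closedI.
- by move=> _ [[v c] [/= [_ Vv] _] <-]; exists v => //; exists c.
move=> _ [[v Vv [c _ <-]] /= vcM]; have cMd := coef _ _ Vv vcM.
exists (v, c) => //; split; last exact: Ckd.
split=> //; apply: VMC; split => //=.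
rewrite -[v](addrK (c *: e)); apply: le_trans (ler_normB _ _) _.
rewrite rmorphD lerD// normrZ rmorphM; exact: ler_pM.
Qed.

Lemma bounded_precompact A :
  finite_dimensional E -> bounded_set A -> precompact A.
Proof.
move=> [n [e span_e]] /bounded_embP[M M0 AM].
pose span (s : seq 'I_n) := foldr
  (fun i V => [set v + c *: e i | v in V & c in [set: K]]) [set 0] s.
have span_sum (c : 'I_n -> K) s : span s (\sum_(i <- s) c i *: e i).
  elim: s => [|i s IH]; first by rewrite big_nil.
  by rewrite big_cons addrC; exists (\sum_(j <- s) c j *: e j) => //; exists (c i).
have lc s : locally_compact_subspace (span s).
  elim: s => [|i s IH]; last exact: locally_compact_subspace_add_line.
  split=> // [c x y -> ->|r]; first by rewrite /= scaler0 addr0.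
  by exists [set 0]; split => [|//|x []//]; exact: compact_set1.
have [_ _ /(_ M)[C [cC _ MC]]] := lc (index_enum 'I_n).
have pC : precompact C by exact: compact_precompact.
apply: precompact_subset pC => x Ax; apply: MC; split; last exact: AM.
by have [c ->] := span_e x; exact: span_sum.
Qed.

End finite_dimension.

(** * Bounded sets, convex combinations and convex hulls *)

Section finite_dimensional_mnc.
Context {E : completeNormedModType K}.
Implicit Types (A B C : set E) (x y : E).
Notation comb := (@convex_comb R K emb E).

Lemma nebounded_convex_comb l A B : 0 <= l <= 1 ->
  nebounded A -> nebounded B -> nebounded (comb l A B).
Proof.
move=> l01 [[a Aa] /bounded_embP[M M0 AM]] [[b Bb] /bounded_embP[N N0 BN]].
split; first by exists (emb l *: a + emb (1 - l) *: b), a => //; exists b.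
apply/bounded_embP; exists (M + N); first exact: addr_gt0.
move=> _ [x Ax [y By <-]].
apply: le_trans (norm_comb_le _ _ _ _ _ l01 (AM _ Ax) (BN _ By)) _.
by rewrite emb_le; move: l01 => /andP[l0 l1]; nra.
Qed.

Lemma nebounded_normball (M : R) : 0 < M ->
  nebounded [set x : E | `|x| <= emb M].
Proof.
move=> M0; split; first by exists 0; rewrite /= normr0 emb_ge0 ltW.
by apply/bounded_embP; exists M.
Qed.

Lemma convex_hull_normball (M : R) A : (forall x, A x -> `|x| <= emb M) ->
  convex_hull A `<=` [set x | `|x| <= emb M].
Proof. by move=> AM; apply: smallest_sub => //; exact: convex_normball. Qed.

Lemma sub_convex_hull A : A `<=` convex_hull A.
Proof. exact: sub_smallest. Qed.

Lemma nebounded_convex_hull A : nebounded A -> nebounded (convex_hull A).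
Proof.
move=> [[a Aa] /bounded_embP[M M0 AM]]; split.
  by exists a; exact: sub_convex_hull.
by apply/bounded_embP; exists M => //; exact: convex_hull_normball.
Qed.

Lemma sub_convex_comb_self l A : A `<=` comb l A A.
Proof.
move=> x Ax; exists x => //; exists x => //.
by rewrite -scalerDl -rmorphD addrC subrK rmorph1 scale1r.
Qed.

Lemma iter_convex_comb_nondecreasing l A m n : (m <= n)%N ->
  iter m (fun X => comb l X X) A `<=` iter n (fun X => comb l X X) A.
Proof.
move=> /subnK <-; elim: (n - m)%N => [|k IH] //.
by apply: subset_trans IH _; rewrite addSn iterS; exact: sub_convex_comb_self.
Qed.

Lemma iter_convex_comb_normball l A (M : R) n : 0 <= l <= 1 ->
  A `<=` [set x | `|x| <= emb M] ->
  iter n (fun X => comb l X X) A `<=` [set x | `|x| <= emb M].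
Proof.
move=> l01 AM; elim: n => [//|n IH] /= _ [x /IH xM [y /IH yM <-]].
by apply: (convex_set_embP _).1 (convex_normball M) _ _ _ _ _ _.
Qed.

(** * Measures convex at one coefficient *)

Section one_coefficient.
Context (mu : set E -> R) (l : R) (mu_ge0 : nonneg_on_nebounded mu)
  (mu_mono : mnc_monotone mu) (l01 : 0 < l < 1) (mu_l : mnc_convex_at emb mu l).

Let l01w : 0 <= l <= 1.
Proof. by move: l01 => /andP[l0 l1]; rewrite !ltW. Qed.

(** If mu is convex at s and r, then it is convex at q = l s + (1 - l) r, since
    q A + (1 - q) B lies in the l-combination of s A + (1 - s) B and
    r A + (1 - r) B. *)
Lemma mnc_convex_at_dense t e : 0 <= t <= 1 -> 0 < e ->
  exists s, [/\ mnc_convex_at emb mu s, 0 <= s, s <= t & t - s <= e].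
Proof.
move=> t01 e0; pose D := [set s | 0 <= s <= 1 /\ mnc_convex_at emb mu s].
have D0 : D 0.
  split=> [|A B bA bB]; first by rewrite lexx ler01.
  rewrite mul0r add0r subr0 mul1r; apply: mu_mono => //.
    by apply: nebounded_convex_comb; rewrite ?lexx ?ler01.
  move=> _ [a _ [b Bb <-]].
  by rewrite subr0 rmorph0 rmorph1 scale0r scale1r add0r.
have D1 : D 1.
  split=> [|A B bA bB]; first by rewrite lexx ler01.
  rewrite subrr mul0r addr0 mul1r; apply: mu_mono => //.
    by apply: nebounded_convex_comb; rewrite ?lexx ?ler01.
  move=> _ [a Aa [b _ <-]].
  by rewrite subrr rmorph0 rmorph1 scale0r scale1r addr0.
have Dl s r : D s -> D r -> D (l * s + (1 - l) * r).
  move=> [s01 mus] [r01 mur].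
  have q01 : 0 <= l * s + (1 - l) * r <= 1.
    move: l01w s01 r01 => /andP[l0 l1] /andP[s0 s1] /andP[r0 r1].
    by apply/andP; split; nra.
  split=> // A B bA bB.
  have bs := nebounded_convex_comb _ _ _ s01 bA bB.
  have br := nebounded_convex_comb _ _ _ r01 bA bB.
  apply: (@le_trans _ _ (mu (comb l (comb s A B) (comb r A B)))).
    apply: mu_mono; try exact: nebounded_convex_comb.
    move=> _ [a Aa [b Bb <-]].
    exists (emb s *: a + emb (1 - s) *: b); first by exists a => //; exists b.
    exists (emb r *: a + emb (1 - r) *: b); first by exists a => //; exists b.
    exact: comb_nested.
  apply: le_trans (mu_l _ _ bs br) _.
  have -> : (l * s + (1 - l) * r) * mu A + (1 - (l * s + (1 - l) * r)) * mu B =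
      l * (s * mu A + (1 - s) * mu B) + (1 - l) * (r * mu A + (1 - r) * mu B).
    by ring.
  move: l01w => /andP[l0 l1].
  by apply: lerD; apply: ler_wpM2l; rewrite ?subr_ge0//; [exact: mus|exact: mur].
have [s [[_ mus] s0 st ts]] := dense_of_comb_closed l D l01 D0 D1 Dl t e t01 e0.
by exists s.
Qed.

(** For a in A and c in C with |a - c| <= 1 - r,
    a = r c + (1 - r) b where b = (a - r c) / (1 - r) has norm at most 1 + M.
    Thus A lies in r C + (1 - r) B for the ball B of radius 1 + M, which does
    not depend on C; let r tend to 1 among the coefficients at which mu is
    convex. *)
Lemma mnc_le_of_approx A (v M : R) : nebounded A ->
  (forall d : R, 0 < d -> exists C,
    [/\ nebounded C, C `<=` [set x | `|x| <= emb M], mu C <= v + d &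
      forall a, A a -> exists2 c, C c & `|a - c| <= emb d]) ->
  mu A <= v.
Proof.
move=> bA approx; apply/ler_addgt0Pr => e e0.
have M0 : 0 <= M.
  have [C [[[c Cc] _] CM _ _]] := approx 1 ltr01.
  by rewrite -emb_ge0; exact: le_trans (normr_ge0 _) (CM _ Cc).
pose B := [set x : E | `|x| <= emb (1 + M)].
have bB : nebounded B by apply: nebounded_normball; lra.
have B0 := mu_ge0 _ bB.
(* r is taken in [1 - 2 h, 1 - h]: close to 1 so that (1 - r) (1 + mu B) <= e,
   but distinct from 1. *)
pose h := Num.min 1 (e / (1 + mu B)) / 2.
have eB : 0 < e / (1 + mu B) by rewrite divr_gt0//; lra.
have m0 : 0 < Num.min 1 (e / (1 + mu B)) by rewrite lt_min ltr01.
have [m1 me] : Num.min 1 (e / (1 + mu B)) <= 1 /\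
    Num.min 1 (e / (1 + mu B)) <= e / (1 + mu B).
  by rewrite !ge_min !lexx orbT.
have h0 : 0 < h by rewrite /h; lra.
have h01 : 0 <= 1 - h <= 1 by rewrite /h; lra.
have [r [mur r0 rh hr]] := mnc_convex_at_dense _ _ h01 h0.
have r1 : 0 < 1 - r by lra.
have r01 : 0 <= r <= 1 by lra.
have re : (1 - r) * (1 + mu B) <= e.
  by rewrite -ler_pdivlMr; [apply: le_trans me; rewrite /h in h0 rh hr *; lra|lra].
have [C [bC CM muC AC]] := approx _ r1.
have C0 := mu_ge0 _ bC.
apply: (@le_trans _ _ (mu (comb r C B))); last first.
  by apply: le_trans (mur _ _ bC bB) _; nra.
apply: mu_mono => //; first exact: nebounded_convex_comb.
move=> a Aa; have [c Cc ac] := AC _ Aa; exists c => //.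
have er : 0 < emb (1 - r) by rewrite emb_gt0.
exists ((emb (1 - r))^-1 *: (a - emb r *: c)); last first.
  by rewrite scalerA divff ?gt_eqF// scale1r addrC subrK.
rewrite /B /= normrZ normfV gtr0_norm// ler_pdivrMl// -rmorphM mulrDr mulr1.
have -> : a - emb r *: c = (a - c) + emb (1 - r) *: c.
  by rewrite embB1 scalerBl scale1r addrA subrK.
apply: le_trans (ler_normD _ _) _; rewrite (rmorphD emb (1 - r)) lerD//.
rewrite normrZ gtr0_norm// rmorphM.
by apply: ler_wpM2l; [exact: ltW|exact: CM].
Qed.

(** t A + (1 - t) B is within (t - s) (M + N) of s A + (1 - s) B when A and B lie
    in the balls of radii M and N. *)
Lemma mnc_convex_everywhere t : 0 <= t <= 1 -> mnc_convex_at emb mu t.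
Proof.
move=> /[dup] t01 /andP[t0 t1] A B bA bB.
have [_ /bounded_embP[M M0 AM]] := bA; have [_ /bounded_embP[N N0 BN]] := bB.
have [A0 B0] : 0 <= mu A /\ 0 <= mu B by split; exact: mu_ge0.
apply: (@mnc_le_of_approx _ _ (M + N)); first exact: nebounded_convex_comb.
(* L bounds both the error on the sets, M + N, and that on the right-hand side,
   mu A + mu B. *)
move=> d d0; pose L := 1 + mu A + mu B + M + N.
have L0 : 0 < L by rewrite /L; lra.
have [s [mus s0 st ts]] := mnc_convex_at_dense _ _ t01 (divr_gt0 d0 L0).
have s01 : 0 <= s <= 1 by lra.
have tsL : (t - s) * L <= d by rewrite -ler_pdivlMr.
exists (comb s A B); split.
- exact: nebounded_convex_comb.
- move=> _ [x Ax [y By <-]] /=.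
  apply: le_trans (norm_comb_le _ _ _ _ _ s01 (AM _ Ax) (BN _ By)) _.
  by rewrite emb_le; nra.
- apply: le_trans (mus _ _ bA bB) _; rewrite /L in tsL; nra.
move=> _ [x Ax [y By <-]].
exists (emb s *: x + emb (1 - s) *: y); first by exists x => //; exists y.
rewrite comb_subl normrZ ger0_norm ?emb_ge0 ?subr_ge0//.
apply: (@le_trans _ _ (emb (t - s) * emb (M + N))).
  rewrite ler_wpM2l ?emb_ge0 ?subr_ge0//; apply: le_trans (ler_normB _ _) _.
  by rewrite rmorphD lerD//; [exact: AM|exact: BN].
rewrite -rmorphM emb_le; rewrite /L in tsL; nra.
Qed.

(** The union U of the increasing iterates is stable under l-combinations, so
    its closure is convex and contains the hull. This closure is compact and
    covered by the open d-neighbourhoods of the iterates, so one of them covers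
    it. *)
Lemma convex_hull_approx A (d : R) : finite_dimensional E -> nebounded A ->
  0 < d -> exists n, forall x, convex_hull A x ->
    exists2 y, iter n (fun X => comb l X X) A y & `|x - y| <= emb d.
Proof.
move=> fdE [[a0 Aa0] /bounded_embP[M M0 AM]] d0.
pose S n := iter n (fun X => comb l X X) A.
pose U := \bigcup_n S n.
have Ul : comb_closed l U.
  move=> x y [m _ Smx] [n _ Sny]; exists (maxn m n).+1 => //.
  exists x; first exact: (iter_convex_comb_nondecreasing _ _ _ _ (leq_maxl m n)).
  exists y => //; exact: (iter_convex_comb_nondecreasing _ _ _ _ (leq_maxr m n)).
have hullU : convex_hull A `<=` closure U.
  apply: smallest_sub; last by move=> x Ax; apply: subset_closure; exists 0.
  apply/convex_set_embP; apply: (convex_of_comb_closed _ _ l01).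
    exact: closed_closure.
  exact: comb_closed_closure.
have bU : bounded_set U.
  by apply/bounded_embP; exists M => // x [n _]; exact: iter_convex_comb_normball.
have : precompact U by exact: bounded_precompact.
rewrite precompactE compact_cover.
move=> /(_ _ setT (fun n => \bigcup_(y in S n) ball y (emb d))) [].
- by move=> n _; apply: bigcup_open => y _; exact: ball_open.
- move=> x /closure_embP /(_ (d / 2)) []; first lra.
  move=> y [n _ Sy] xy; exists n => //; exists y => //.
  rewrite -ball_normE /= distrC; apply: le_lt_trans xy _.
  by rewrite (leW_mono emb_le); lra.
move=> D _ UD; exists (\max_(i <- finmap.enum_fset D) i)%N => x.
move=> /hullU /UD[n /= Dn [y Sy yx]].
exists y; last by move: yx; rewrite -ball_normE /= distrC => /ltW.
by apply: iter_convex_comb_nondecreasing Sy; exact: leq_bigmax_seq.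
Qed.

(** The iterates of X |-> l X + (1 - l) X have measure at most mu A by convexity
    at l, and approximate the hull. *)
Lemma mnc_convex_hull_eq A : finite_dimensional E -> nebounded A ->
  mu (convex_hull A) = mu A.
Proof.
move=> fdE bA; have bH := nebounded_convex_hull _ bA.
apply/eqP; rewrite eq_le; apply/andP; split; last first.
  by apply: mu_mono => //; exact: sub_convex_hull.
have [_ /bounded_embP[M M0 AM]] := bA.
have S_ok n : let S := iter n (fun X => comb l X X) A in
    nebounded S /\ mu S <= mu A.
  elim: n => [|n [bS muS]] //=; split; first exact: nebounded_convex_comb.
  apply: le_trans muS; apply: le_trans (mu_l _ _ bS bS) _.
  by rewrite -mulrDl addrC subrK mul1r.
apply: (@mnc_le_of_approx _ _ M) => // d d0.
have [n nH] := convex_hull_approx _ _ fdE bA d0.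
exists (iter n (fun X => comb l X X) A); have [bS muS] := S_ok n.
by split => //; [exact: iter_convex_comb_normball|lra].
Qed.

End one_coefficient.

(** * Characterization of axiomatic measures in finite dimension *)

Lemma nested_bigcap_neq0 (A : nat -> set E) : finite_dimensional E ->
  (forall n, nebounded (A n)) -> (forall n, closed (A n)) ->
  (forall n, A n.+1 `<=` A n) -> \bigcap_n A n !=set0.
Proof.
move=> fdE bA cA decA.
have decA' m n : (m <= n)%N -> A n `<=` A m.
  move=> /subnK <-; elim: (n - m)%N => [|k IH] //.
  by rewrite addSn; exact: subset_trans (decA _) IH.
have cptA : compact (A 0).
  by rewrite -precompact_closed//; apply: bounded_precompact fdE (bA 0).2.
pose F := filter_from setT A.
have FF : ProperFilter F.
  apply: filter_from_proper; last by move=> n _; exact: (bA n).1.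
  apply: filter_from_filter; first by exists 0.
  move=> m n _ _; exists (maxn m n) => // x Ax.
  by split; apply: decA' Ax; rewrite ?leq_maxl ?leq_maxr.
have [|p [_ Fp]] := cptA F FF; first by exists 0.
exists p => n _; rewrite (closure_id (A n)).1//.
by move: Fp; rewrite clusterE; apply; exists n.
Qed.

Lemma axiomatic_mncP (mu : set E -> R) :
  finite_dimensional E -> nonneg_on_nebounded mu ->
  axiomatic_mnc emb mu <->
  [/\ mnc_ker mu !=set0, mnc_monotone mu &
      exists2 l : R, 0 < l < 1 & mnc_convex_at emb mu l].
Proof.
move=> fdE mu_ge0; split.
  move=> [ker0 _ mono _ cvx _]; split => //; exists (1 / 2); first lra.
  by apply: cvx; lra.
move=> [ker0 mono [l l01 mul]]; split => //.
- by move=> A [bA _]; exact: bounded_precompact fdE bA.2.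
- by move=> A bA; exact: (mnc_convex_hull_eq mu l).
- by move=> t; exact: (mnc_convex_everywhere mu l).
- by move=> A bA cA decA _; exact: nested_bigcap_neq0.
Qed.

End finite_dimensional_mnc.
End real_scalars.

Theorem mainTheorem7 (R : realType) :
  (forall E : completeNormedModType R,
     finite_dimensional E ->
     forall mu : set E -> R, nonneg_on_nebounded mu ->
       axiomatic_mnc (@idfun R) mu <->
       [/\ mnc_ker mu !=set0,
           mnc_monotone mu &
           exists2 l : R, 0 < l < 1 & mnc_convex_at (@idfun R) mu l]) /\
  (forall E : completeNormedModType (complex R),
     finite_dimensional E ->
     forall mu : set E -> R, nonneg_on_nebounded mu ->
       axiomatic_mnc (@real_complex R) mu <->
       [/\ mnc_ker mu !=set0,
           mnc_monotone mu &
           exists2 l : R, 0 < l < 1 & mnc_convex_at (@real_complex R) mu l]).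
Proof.
split=> E fdE mu mu_ge0.
  apply: (@axiomatic_mncP R R idfun _ _ 0) => //; first by move=> k _; exists k.
  move=> k r kr; exists k, 0; split => //=; last by rewrite mul0r addr0.
  by rewrite normr0; exact: le_trans kr.
apply: (@axiomatic_mncP R (complex R) (real_complex R) _ _ 'i%C) => //.
- exact: lecR.
- move=> k; rewrite lecE /= => /andP[/eqP k0 _]; exists (complex.Re k).
  by move: k0; case: k => a b /= ->.
move=> k r kr; exists (complex.Re k), (complex.Im k); split.
- by rewrite -lecR; apply: le_trans kr; exact: normc_ge_Re.
- rewrite -lecR; apply: le_trans kr; rewrite normc_def lecR -sqrtr_sqr.
  by apply: ler_wsqrtr; rewrite lerDr sqr_ge0.
- exact: complexE.
Qed.
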